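(* Let $\mathbb{F}_q$ be a finite field and $n\ge 2$. The eigenvalues of the Radon transform $\mathcal{R}_n$ of type $\lambda=(n-1,1)$ in the Yokonuma-Hecke algebra $\mathcal{H}(GL_n(\mathbb{F}_q),U_{(1^n)})$ are contained in $\{1,q,q^2,\dots,q^{2n-2}\}$.
   Context: For a tuple $\mu$ of positive integers with sum $n$, $U_\mu\subset GL_n(\mathbb{F}_q)$ is the group of block upper triangular matrices whose diagonal blocks are identity matrices of sizes given by $\mu$, and $U_\mu^{op}$ is the group of transposes; $U_{(1^n)}=U_{(1,\dots,1)}$ is the group of upper triangular matrices with $1$'s on the diagonal. For a subgroup $H$ of a finite group $G$, $e_H=\frac{1}{|H|}\sum_{h\in H}h\in\mathbb{C}[G]$. Let $\lambda=(n-1,1)$ and $\mathcal{R}=|U_\lambda|^2e_{U_\lambda}e_{U_\lambda^{op}}e_{U_\lambda}\in\mathbb{C}[GL_n(\mathbb{F}_q)]$ be the Radon element. The Yokonuma-Hecke algebra is $\mathcal{H}(GL_n(\mathbb{F}_q),U_{(1^n)})=e\,\mathbb{C}[GL_n(\mathbb{F}_q)]\,e$ with unit $e=e_{U_{(1^n)}}$. The element $\mathcal{R}$ commutes with $e$, and $\mathcal{R}_n$ denotes the element $e\mathcal{R}e=\mathcal{R}e$ of the Yokonuma-Hecke algebra; its eigenvalues are those of right multiplication by $\mathcal{R}_n$ on $e\,\mathbb{C}[GL_n(\mathbb{F}_q)]\,e$. *)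

(* Defs.v *)
From mathcomp Require Import all_boot all_order all_algebra.
From mathcomp Require Import all_fingroup mxrepresentation.
From mathcomp Require Import reals.
From mathcomp Require Export complex.

Set Implicit Arguments.
Unset Strict Implicit.
Unset Printing Implicit Defensive.

Import GRing.Theory GroupScope.
Local Open Scope ring_scope.

Section Unipotent.

Variables (F : finFieldType) (n : nat).

(* [reshape_index mu i] is the position in [mu] of the block containing the
   (0-based) index [i]; so this says that [A] is block upper triangular with
   identity diagonal blocks of sizes [mu].  It is meant for [sumn mu = n] and
   0 < n: {'GL_n[F]} consists of matrices of size n.-1.+1. *)
Definition block_unitriangular (mu : seq nat) (A : 'M[F]_n.-1.+1) : bool :=
  [forall i : 'I_n.-1.+1, forall j : 'I_n.-1.+1,
     ((reshape_index mu j < reshape_index mu i)%N ==> (A i j == 0)) &&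
     ((reshape_index mu i == reshape_index mu j) ==> (A i j == (i == j)%:R))].

Definition unip_set (mu : seq nat) : {set {'GL_n[F]}} :=
  [set g | block_unitriangular mu (GLval g)].

Definition unip_op_set (mu : seq nat) : {set {'GL_n[F]}} :=
  [set g | block_unitriangular mu (GLval g)^T].

Lemma block_unitriangular1 mu : block_unitriangular mu 1.
Proof.
apply/forallP=> i; apply/forallP=> j /=; rewrite mxE.
case: (eqVneq i j) => [->|_]; first by rewrite ltnn !eqxx.
by rewrite eqxx !implybT.
Qed.

Lemma block_unitriangularM mu A B :
  block_unitriangular mu A -> block_unitriangular mu B ->
  block_unitriangular mu (A *m B).
Proof.
have le_block D : block_unitriangular mu D -> forall i j : 'I_n.-1.+1,
    (reshape_index mu j <= reshape_index mu i)%N -> D i j = (i == j)%:R.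
  move=> /forallP/= D_P i j le_ji.
  have /forallP/(_ j)/andP[/implyP lt_P /implyP eq_P] := D_P i.
  move: le_ji; rewrite leq_eqVlt => /orP[/eqP ji|lt_ji].
    by apply/eqP/eq_P; rewrite ji.
  rewrite (eqP (lt_P lt_ji)); case: eqVneq lt_ji => // ->.
  by rewrite ltnn.
move=> /le_block A_P /le_block B_P.
have AB_P (i j : 'I_n.-1.+1) : (reshape_index mu j <= reshape_index mu i)%N ->
    (A *m B) i j = (i == j)%:R.
  move=> le_ji; rewrite mxE (bigD1 i) //= A_P // eqxx mul1r B_P //.
  rewrite big1 ?addr0 // => k ne_ki.
  have [le_ki|lt_ik] := leqP (reshape_index mu k) (reshape_index mu i).
    by rewrite A_P // eq_sym (negPf ne_ki) mul0r.
  rewrite B_P ?(leq_trans le_ji (ltnW lt_ik)) //.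
  case: eqVneq => [kj|_]; last by rewrite mulr0.
  by move: lt_ik; rewrite kj ltnNge le_ji.
apply/forallP=> i; apply/forallP=> j; apply/andP; split; apply/implyP.
  move=> lt_ji; rewrite AB_P ?(ltnW lt_ji) //.
  by case: (eqVneq i j) lt_ji => [->|_ _]; rewrite ?ltnn ?eqxx.
by move=> /eqP ij; rewrite AB_P // ij.
Qed.

Fact unip_group_set mu : group_set (unip_set mu).
Proof.
apply/group_setP; split=> [|x y]; first by rewrite inE block_unitriangular1.
by rewrite !inE; apply: block_unitriangularM.
Qed.

Fact unip_op_group_set mu : group_set (unip_op_set mu).
Proof.
apply/group_setP; split=> [|x y].
  by rewrite inE GL_1E trmx1 block_unitriangular1.
rewrite !inE GL_MxE trmx_mul => Ux Uy; exact: block_unitriangularM.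
Qed.

Definition unip mu : {group {'GL_n[F]}} := Group (unip_group_set mu).
Definition unip_op mu : {group {'GL_n[F]}} := Group (unip_op_group_set mu).

End Unipotent.

Section HeckeAlgebra.

Variables (C : fieldType) (gT : finGroupType) (G : {group gT}).

(* The group algebra C[G] is the library's [group_ring C G]: the span of the
   matrices of the (faithful) regular representation of G, multiplied by [*m];
   [gset_mx C G A] is the formal sum of the elements of A. *)
Definition avg (H : {group gT}) : 'M[C]_#|G| := #|H|%:R^-1 *: gset_mx C G H.

(* e_H C[G] e_H *)
Definition hecke_algebra (H : {group gT}) : 'A[C]_#|G| :=
  (mxvec (avg H) * group_ring C G * mxvec (avg H))%MS.

Lemma hecke_algebraP (H : {group gT}) (v : 'M[C]_#|G|) :
  reflect (exists2 x, (x \in group_ring C G)%MS & v = avg H *m x *m avg H)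
          (v \in hecke_algebra H)%MS.
Proof.
have lineP (w x : 'M[C]_#|G|) : (x \in mxvec w)%MS -> {c | x = c *: w}.
  move=> /sub_rVP/sig_eqW[c xE]; exists c.
  by apply: (can_inj mxvecK); rewrite linearZ xE.
apply: (iffP idP) => [|[x Gx ->]]; last by rewrite !mem_mulsmx ?submx_refl.
case/mulsmxP=> A A_P [B B_P ->].
pose c i := sval (lineP _ _ (B_P i)).
have -> : \sum_i A i *m B i = (\sum_i c i *: A i) *m avg H.
  rewrite mulmx_suml; apply: eq_bigr => i _.
  by rewrite (svalP (lineP _ _ (B_P i))) -scalemxAl -scalemxAr.
have: (\sum_i c i *: A i \in mxvec (avg H) * group_ring C G)%MS.
  by rewrite linear_sum summx_sub // => i _; rewrite linearZ /= scalemx_sub ?A_P.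
case/mulsmxP=> D D_P [E E_P ->].
pose d i := sval (lineP _ _ (D_P i)).
exists (\sum_i d i *: E i).
  by rewrite linear_sum summx_sub // => i _; rewrite linearZ /= scalemx_sub ?E_P.
rewrite mulmx_sumr; congr (_ *m _); apply: eq_bigr => i _.
by rewrite (svalP (lineP _ _ (D_P i))) -scalemxAl -scalemxAr.
Qed.

(* [a] is an eigenvalue of the endomorphism v |-> v r of [V] (which is only
   meaningful when V is stable under it). *)
Definition right_mul_eigenvalue m (V : 'A[C]_(m, #|G|)) (r : 'M[C]_#|G|)
    (a : C) : Prop :=
  exists v : 'M[C]_#|G|, [/\ (v \in V)%MS, v != 0 & v *m r = a *: v].

End HeckeAlgebra.

Section Radon.

Variables (C : fieldType) (F : finFieldType) (n : nat).

Local Notation G := ('GL_n[F])%G.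
Local Notation e_ := (avg C G).

Definition radon (la : seq nat) : 'M[C]_#|G| :=
  let U := unip F n la in
  let Uop := unip_op F n la in
  (#|U| ^ 2)%N%:R *: (e_ U *m e_ Uop *m e_ U).

Definition unip1n : {group {'GL_n[F]}} := unip F n (nseq n 1%N).

Definition yokonuma_hecke : 'A[C]_#|G| := hecke_algebra C G unip1n.

(* e R e, with e the unit of the Yokonuma-Hecke algebra *)
Definition radon_yokonuma (la : seq nat) : 'M[C]_#|G| :=
  e_ unip1n *m radon la *m e_ unip1n.

End Radon.

(* Main.v *)
Require Import Defs.
From mathcomp Require Import all_boot all_order all_algebra.
From mathcomp Require Import all_fingroup mxrepresentation.
From mathcomp Require Import reals complex.
From mathcomp Require Import spectral ring zify.

Set Implicit Arguments.
Unset Strict Implicit.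
Unset Printing Implicit Defensive.

Import GRing.Theory Num.Theory.
Local Open Scope ring_scope.

(** Let q be the order of F, let U be the group of upper unitriangular matrices
and e its averaging idempotent.  The Radon element of type (n-1,1) is the last
term of a family of commuting elements of the Yokonuma-Hecke algebra, one for
each index l counted from 0,

  J_l = q^(2l) e y_l e,

where y_l is the average of the matrices that differ from the identity only in
row l, left of the diagonal.  These are the Jucys-Murphy elements: J_0 = e, and
for adjacent indices k and l = k+1 the recursion J_l = T J_k T* holds
([jucys_murphy_step]), where T = q e s e and T* = q e s^-1 e come from a
monomial matrix s of determinant 1 exchanging the coordinates k and l.  They
satisfy the quadratic relation ([hecke_quadratic])

  T T* = T* T = q e + (q - 1) E T,

where E is the idempotent of the one-dimensional torus of the SL_2 of the
coordinates k, l; E commutes with everything in sight, and E T* = E T.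

The eigenvalues are then computed by induction on l.  J_k and J_l commute
([jucys_murphy_comm]), so that a J_l-eigenvalue b can be compared with the
J_k-eigenvalues on its eigenspace.  Where E acts by 0, T T* = q, and conjugation
by T shows that b / q is an eigenvalue of J_k.  Where E acts by 1, T = T* and
T satisfies the Iwahori-Hecke relation (T - q)(T + 1) = 0, and the study of the
span of u and u T, for a common eigenvector u of J_k and J_l, shows that b / q
is an eigenvalue of J_k unless b = q^2 a or b = a for an eigenvalue a of J_k
([hecke_eigenvalue_step]).  Hence the exponent of q grows by at most 2 at each
of the n - 1 steps, starting from the eigenvalue 1 of J_0.

Most identities between averages are proved without counting: for a group of
matrices S with average m, an element X is fixed by m as soon as it is fixed by
every element of S ([mean_fixl], [mean_fixr]), and g m = m' g as soon as g
conjugates S to the group S' with average m' ([mean_conj]).  The groups that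
occur are described by the set of positions (i, j) where their elements may
differ from the identity, so each such conjugation becomes a statement about
composing relations on indices. *)

(** * Eigenvectors in stable subspaces and the inductive step *)

Lemma stable_eigenvector (C : numClosedFieldType) m n (V : 'M[C]_(m, n))
    (A : 'M[C]_n) :
  V != 0 -> stablemx V A ->
  exists a (v : 'rV[C]_n), [/\ v != 0, (v <= V)%MS & v *m A = a *: v].
Proof.
move=> V0 VA; have rV : (0 < \rank V)%N by rewrite lt0n mxrank_eq0.
have [a /eigenvalueP[v vA v0]] := eigenvalue_closed (restrictmx V A) rV.
exists a, (v *m row_base V); split.
- by rewrite mulmx_free_eq0 ?row_base_free.
- by rewrite mulmx_sub // eq_row_base.
apply/eigenspaceP; rewrite -stablemx_row_base in VA.
by rewrite -sub_eigenspace_conjmx ?row_base_free //; apply/eigenspaceP.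
Qed.

Lemma stablemxI (K : fieldType) m1 m2 n (V : 'M[K]_(m1, n))
    (W : 'M[K]_(m2, n)) (f : 'M[K]_n) :
  stablemx V f -> stablemx W f -> stablemx (V :&: W)%MS f.
Proof.
move=> Vf Wf; rewrite sub_capmx; apply/andP; split.
  exact: submx_trans (submxMr _ (capmxSl _ _)) Vf.
exact: submx_trans (submxMr _ (capmxSr _ _)) Wf.
Qed.

(** A and B = T A T* play the parts of two consecutive Jucys-Murphy elements.
If T* T = q, then v B = b v reads (v T) A = (b / q) (v T).  If T = T*, then on
the span of u (an A-eigenvector with u B = b u) and w = u T the matrix of A is
triangular with diagonal entries a and b / q, so b / q is again an eigenvalue,
except if w is a multiple of u; that multiple is then q or -1, the roots of the
quadratic relation, and b is its square times a. *)
Lemma hecke_eigenvalue_step (C : numClosedFieldType) N (q b : C)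
    (e E A T Ts : 'M[C]_N) (v : 'rV[C]_N) :
  q != 0 ->
  e *m A = A -> A *m e = A -> T *m e = T ->
  E *m E = E -> E *m e = e *m E -> E *m A = A *m E -> E *m T = T *m E ->
  E *m Ts = E *m T ->
  T *m Ts = q *: e + (q - 1) *: (E *m T) ->
  Ts *m T = q *: e + (q - 1) *: (E *m T) ->
  A *m (T *m A *m Ts) = T *m A *m Ts *m A ->
  E *m Ts = Ts *m E ->
  v != 0 -> v *m e = v -> v *m (T *m A *m Ts) = b *: v ->
  exists a (w : 'rV[C]_N), [/\ w != 0, w *m e = w, w *m A = a *: w &
    [\/ b = a, b = q * a | b = q ^+ 2 * a]].
Proof.
move=> q0 eA Ae Te EE Ee EA ET ETs TTs TsT AB TsE v0 ve vB.
(* Either E kills v, or v E is an eigenvector with the same b fixed by E. *)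
have [vE|vE] := eqVneq (v *m E) 0.
  exists (b / q), (v *m T); split.
  - apply/eqP=> vT0; have := congr1 (mulmx v) TTs.
    rewrite mulmxDr -!scalemxAr !mulmxA vT0 vE ve !mul0mx scaler0 addr0.
    by move/esym/eqP; rewrite scaler_eq0 (negPf q0) (negPf v0).
  - by rewrite -mulmxA Te.
  - have := congr1 (mulmx^~ T) vB.
    rewrite -!mulmxA TsT !mulmxDr -!scalemxAr !mulmxA.
    have -> : v *m T *m A *m E = 0.
      by rewrite -!mulmxA -EA !mulmxA -(mulmxA v) -ET mulmxA vE !mul0mx.
    rewrite mul0mx scaler0 addr0 -(mulmxA _ A) Ae -scalemxAl.
    move/(congr1 ( *:%R q^-1)); rewrite !scalerA mulVf // scale1r => ->.
    by rewrite mulrC.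
  - by apply: Or32; rewrite mulrCA divff ?mulr1.
pose V := (eigenspace e 1 :&:
  (eigenspace E 1 :&: eigenspace (T *m A *m Ts) b))%MS.
have EB : E *m (T *m A *m Ts) = T *m A *m Ts *m E.
  by rewrite !mulmxA ET -(mulmxA T) EA -!mulmxA TsE.
have V0 : V != 0.
  apply: contra_neq vE => V0; apply/eqP; rewrite -submx0 -V0.
  rewrite !sub_capmx; apply/and3P; split; apply/eigenspaceP.
  - by rewrite -mulmxA Ee mulmxA ve scale1r.
  - by rewrite -mulmxA EE scale1r.
  - by rewrite -(mulmxA v E) EB mulmxA vB scalemxAl.
have VA : stablemx V A.
  by rewrite !stablemxI ?comm_mx_stable_eigenspace //
    /comm_mx ?eA ?Ae ?EA // AB !mulmxA.
have [a [u [u0 uV uA]]] := stable_eigenvector V0 VA.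
move: uV; rewrite !sub_capmx.
case/and3P=> /eigenspaceP ue /eigenspaceP uE /eigenspaceP uB.
rewrite scale1r in ue; rewrite scale1r in uE.
pose w := u *m T.
have fix_Ts (x : 'rV_N) : x *m E = x -> x *m Ts = x *m T.
  by move=> xE; rewrite -xE -!mulmxA ETs.
have wE : w *m E = w by rewrite /w -mulmxA -ET mulmxA uE.
have wAT : w *m A *m T = b *: u.
  rewrite -fix_Ts; first by rewrite -uB !mulmxA.
  by rewrite -mulmxA -EA mulmxA wE.
have TT (x : 'rV_N) : x *m E = x -> x *m e = x ->
    x *m T *m T = q *: x + (q - 1) *: (x *m T).
  move=> xE xe; rewrite -fix_Ts; last by rewrite -mulmxA -ET mulmxA xE.
  by rewrite -mulmxA TTs mulmxDr -!scalemxAr mulmxA xE xe.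
have wA : w *m A = (b / q) *: w - ((q - 1) * b / q) *: u.
  have := congr1 (mulmx^~ T) wAT.
  rewrite TT; last 2 first.
  - by rewrite -mulmxA -EA mulmxA wE.
  - by rewrite -mulmxA Ae.
  rewrite wAT -scalemxAl -/w => /esym/eqP; rewrite -subr_eq => /eqP/esym.
  move/(congr1 ( *:%R q^-1)); rewrite !scalerA mulVf // scale1r => ->.
  by rewrite scalerBr !scalerA; congr (_ *: _ - _ *: _); ring.
have [bqa|bqa] := eqVneq b (q * a).
  by exists a, u; split=> //; apply: Or32.
(* The t for which w + t u is an eigenvector of A, if it does not vanish. *)
pose t := (q - 1) * b / (q * a - b).
have den0 : q * a - b != 0 by rewrite subr_eq0 eq_sym.
have [w'0|w'0] := eqVneq (w + t *: u) 0; last first.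
  exists (b / q), (w + t *: u); split=> //.
  - by rewrite mulmxDl -scalemxAl ue /w -mulmxA Te.
  - rewrite mulmxDl -scalemxAl uA wA scalerDr !scalerA -addrA; congr (_ + _).
    rewrite -scaleNr -scalerDl; congr (_ *: _); rewrite /t; field.
    by rewrite q0 den0.
  - by apply: Or32; rewrite mulrCA divff ?mulr1.
have uT : u *m T = (- t) *: u by apply/eqP; rewrite scaleNr -addr_eq0 w'0.
have inj (x y : C) : x *: u = y *: u -> x = y.
  move/eqP; rewrite -subr_eq0 -scalerBl scaler_eq0 (negPf u0) orbF subr_eq0.
  by move/eqP.
have bE : b = t ^+ 2 * a.
  apply: inj; rewrite -wAT /w uT -!scalemxAl uA -!scalemxAl uT !scalerA.
  by congr (_ *: _); ring.
have tq : (t + q) * (t - 1) = 0.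
  have := TT u uE ue; rewrite uT -!scalemxAl uT !scalerA -scalerDl => /inj tE.
  by apply/eqP; rewrite -(subrr (- t * - t)) {2}tE; apply/eqP; ring.
exists a, u; split=> //; move/eqP: tq; rewrite mulf_eq0 addr_eq0 subr_eq0.
case/orP=> /eqP tE; [apply: Or33|apply: Or31]; rewrite bE tE; ring.
Qed.

(** * Groups of matrices prescribed by their support *)

Section Patterns.
Variables (F : finFieldType) (d : nat).
Implicit Types (r : rel 'I_d) (A B M : 'M[F]_d).

Definition supported r A := forall i j, ~~ r i j -> A i j = 0.

Definition pattern r : {set 'M[F]_d} :=
  [set A : 'M[F]_d | [forall i, forall j, ~~ r i j ==> (A i j == (i == j)%:R)]].

Definition mask r M : 'M[F]_d := \matrix_(i, j) (if r i j then M i j else 0).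

Lemma supported_mask r M : supported r (mask r M).
Proof. by move=> i j /negPf rij; rewrite mxE rij. Qed.

Lemma patternP r A : reflect (supported r (A - 1%:M)) (A \in pattern r).
Proof.
rewrite inE; apply: (iffP 'forall_forallP) => [rA i j nr|rA i j].
  by have /implyP/(_ nr)/eqP := rA i j; rewrite !mxE => ->; rewrite subrr.
apply/implyP=> nr; have := rA i j nr; rewrite !mxE => /eqP.
by rewrite subr_eq0.
Qed.

Lemma pattern1D r M : supported r M -> 1%:M + M \in pattern r.
Proof. by move=> rM; apply/patternP; rewrite addrC addKr. Qed.

Lemma supportedM (r1 r2 r3 : rel 'I_d) A B :
  (forall i a j, r1 i a -> r2 a j -> r3 i j) ->
  supported r1 A -> supported r2 B -> supported r3 (A *m B).
Proof.
move=> r123 sA sB i j nr; rewrite mxE big1 // => a _.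
have [ria|/sA->] := boolP (r1 i a); last by rewrite mul0r.
have [raj|/sB->] := boolP (r2 a j); last by rewrite mulr0.
by rewrite (r123 _ _ _ ria raj) in nr.
Qed.

Lemma supported0 A : supported (fun _ _ => false) A -> A = 0.
Proof. by move=> sA; apply/matrixP=> i j; rewrite sA // mxE. Qed.

Lemma supportedD r A B : supported r A -> supported r B -> supported r (A + B).
Proof. by move=> sA sB i j nr; rewrite mxE sA // sB // addr0. Qed.

Lemma pattern1 r : 1%:M \in pattern r.
Proof. by apply/patternP=> i j _; rewrite !mxE subrr. Qed.

(** A (1 + P) B = 1 + A P B, so only the supports of A, P and B matter. *)
Lemma pattern_conj (w r r' : rel 'I_d) A B M :
  A *m B = 1%:M -> supported w A -> supported w B ->
  (forall i a b j, w i a -> r a b -> w b j -> r' i j) ->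
  M \in pattern r -> A *m M *m B \in pattern r'.
Proof.
move=> AB wA wB wrw /patternP rM; apply/patternP.
have -> : A *m M *m B - 1%:M = A *m ((M - 1%:M) *m B).
  by rewrite mulmxBl mulmxBr mul1mx AB mulmxA.
apply: (@supportedM w (fun a j => [exists b, r a b && w b j])) => //.
  by move=> i a j wia /existsP[b /andP[rab wbj]]; apply: wrw wia rab wbj.
apply: supportedM rM wB => a b j rab wbj.
by apply/existsP; exists b; rewrite rab.
Qed.

(** With M1 and M2 the parts of A - 1 supported by r1 and r2, the absence of
chains r1 i a, r2 a j gives M1 M2 = 0, hence A = (1 + M1)(1 + M2). *)
Lemma pattern_split (r r1 r2 : rel 'I_d) A :
  (forall i j, r i j = r1 i j || r2 i j) ->
  (forall i j, r1 i j -> r2 i j -> false) ->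
  (forall i a j, r1 i a -> r2 a j -> false) ->
  A \in pattern r ->
  exists A1 A2, [/\ A1 \in pattern r1, A2 \in pattern r2 & A = A1 *m A2].
Proof.
move=> r12 disj chain /patternP rA; set N := A - 1%:M in rA.
exists (1%:M + mask r1 N), (1%:M + mask r2 N); split.
- exact/pattern1D/supported_mask.
- exact/pattern1D/supported_mask.
rewrite mulmxDl mul1mx mulmxDr mulmx1.
rewrite [mask r1 N *m _]supported0 ?addr0; last first.
  apply: supportedM chain _ _; exact: supported_mask.
apply/matrixP=> i j; have := rA i j; have := disj i j; rewrite r12.
rewrite /N !mxE; case: (r1 i j); case: (r2 i j) => //= dj nr.
- by have := dj isT isT.
- by rewrite addr0 addrC subrK.
- by rewrite addr0 addrC subrK.
- by rewrite !addr0; apply/eqP; rewrite -subr_eq0 nr.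
Qed.

Definition mgroup (S : {set 'M[F]_d}) :=
  [/\ 1%:M \in S, {in S &, forall A B, A *m B \in S} & {subset S <= unitmx}].

Definition triangular r :=
  [\/ forall i j : 'I_d, r i j -> (i < j)%N
    | forall i j : 'I_d, r i j -> (j < i)%N].

Lemma pattern_group r : transitive r -> triangular r -> mgroup (pattern r).
Proof.
move=> rT rtri; split; first exact: pattern1.
  move=> A B /patternP rA /patternP rB; apply/patternP.
  have -> : A *m B - 1%:M = (A - 1%:M) *m (B - 1%:M) + (A - 1%:M) + (B - 1%:M).
    rewrite mulmxBl mul1mx mulmxBr mulmx1; move: (A *m B) => AB.
    by apply/matrixP=> i j; rewrite !mxE; ring.
  do 2![apply: supportedD => //]; apply: supportedM rA rB => i a j.
  exact: rT.
move=> A; rewrite inE => /'forall_forallP rA.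
have Aii i : A i i = 1.
  have /implyP/(_ _)/eqP -> := rA i i; rewrite ?eqxx //.
  by apply/negP => rii; case: rtri => /(_ _ _ rii); rewrite ltnn.
have A0 i j : ~~ r i j -> i != j -> A i j = 0.
  by move=> nr ij; have /implyP/(_ nr)/eqP -> := rA i j; rewrite (negPf ij).
rewrite unitmxE; case: rtri => rtri; [rewrite -det_tr|]; rewrite det_trig.
- by rewrite big1 ?unitr1 // => i _; rewrite mxE.
- apply/is_trig_mxP=> i j ij; rewrite mxE A0 //.
    by apply/negP=> /rtri; rewrite ltnNge ltnW.
  by rewrite eq_sym -val_eqE neq_ltn ij.
- by rewrite big1 ?unitr1 // => i _.
apply/is_trig_mxP=> i j ij; rewrite A0 //.
  by apply/negP=> /rtri; rewrite ltnNge ltnW.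
by rewrite -val_eqE neq_ltn ij.
Qed.

Lemma mgroup_lmul S A : mgroup S -> A \in S -> [set A *m B | B in S] = S.
Proof.
move=> [_ SM SU] AS; apply/eqP; rewrite eqEcard; apply/andP; split.
  by apply/subsetP=> _ /imsetP[B BS ->]; apply: SM.
by rewrite card_in_imset // => B B' _ _ /(can_inj (mulKmx (SU _ AS))).
Qed.

Lemma mgroup_rmul S A : mgroup S -> A \in S -> [set B *m A | B in S] = S.
Proof.
move=> [_ SM SU] AS; apply/eqP; rewrite eqEcard; apply/andP; split.
  by apply/subsetP=> _ /imsetP[B BS ->]; apply: SM.
by rewrite card_in_imset // => B B' _ _ /(can_inj (mulmxK (SU _ AS))).
Qed.

Lemma mgroup_inv S A : mgroup S -> A \in S ->
  exists B, [/\ B \in S, A *m B = 1%:M & B *m A = 1%:M].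
Proof.
move=> gS AS; have: 1%:M \in [set A *m B | B in S].
  by rewrite mgroup_lmul //; case: gS.
by case/imsetP=> B BS AB; exists B; split=> //; apply: mulmx1C.
Qed.

Lemma card_pattern r :
  #|pattern r| = (#|F| ^ #|[set p : 'I_d * 'I_d | r p.1 p.2]|)%N.
Proof.
pose D := [set p : 'I_d * 'I_d | r p.1 p.2].
pose f (g : {ffun 'I_d * 'I_d -> F}) : 'M[F]_d :=
  1%:M + \matrix_(i, j) g (i, j).
have f_inj : injective f.
  move=> g g' /addrI/matrixP E; apply/ffunP=> -[i j].
  by have := E i j; rewrite !mxE.
rewrite -(card_pffun_on 0 (mem D) (mem F)) -(card_imset _ f_inj).
apply: eq_card => A; apply/patternP/imsetP => [rA|[g gP ->]].
  exists [ffun p => (A - 1%:M) p.1 p.2].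
    apply/pffun_onP; split=> //; apply/subsetP=> -[i j].
    by rewrite !inE ffunE /=; apply: contraNT => /rA->.
  by apply/matrixP=> i j; rewrite !mxE ffunE !mxE addrC subrK.
rewrite addrC addKr => i j nr; rewrite mxE; apply/eqP.
move/pffun_onP: gP => [/subsetP/(_ (i, j)) gD _].
by apply: contraNT nr => gij; have := gD gij; rewrite inE.
Qed.

End Patterns.

(** * Averages over groups of matrices in a representation *)

Section Means.
Variables (F : finFieldType) (d : nat) (C : numFieldType) (N : nat).
Variable rho : 'M[F]_d -> 'M[C]_N.
Hypothesis rho1 : rho 1%:M = 1%:M.
Hypothesis rhoM : forall A B, rho (A *m B) = rho A *m rho B.
Implicit Types (S T : {set 'M[F]_d}) (A B : 'M[F]_d).

Definition mean S : 'M[C]_N := locked (#|S|%:R^-1 *: \sum_(A in S) rho A).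

Lemma meanE S : mean S = #|S|%:R^-1 *: \sum_(A in S) rho A.
Proof. by rewrite /mean -lock. Qed.

Lemma card_mgroup_neq0 S : mgroup S -> #|S|%:R != 0 :> C.
Proof.
by case=> S1 _ _; rewrite pnatr_eq0 -lt0n; apply/card_gt0P; exists 1%:M.
Qed.

Lemma mean_sum S : mgroup S -> #|S|%:R *: mean S = \sum_(A in S) rho A.
Proof.
by move=> gS; rewrite meanE scalerA mulfV ?scale1r ?card_mgroup_neq0.
Qed.

Lemma mean_mull S A : mgroup S -> A \in S -> rho A *m mean S = mean S.
Proof.
move=> gS AS; rewrite meanE -scalemxAr mulmx_sumr; congr (_ *: _).
rewrite -{2}(mgroup_lmul gS AS) big_imset /=.
  by apply: eq_bigr => B _; rewrite rhoM.
by move=> B B' _ _; case: gS => _ _ SU; apply: (can_inj (mulKmx (SU _ AS))).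
Qed.

Lemma mean_mulr S A : mgroup S -> A \in S -> mean S *m rho A = mean S.
Proof.
move=> gS AS; rewrite meanE -scalemxAl mulmx_suml; congr (_ *: _).
rewrite -{2}(mgroup_rmul gS AS) big_imset /=.
  by apply: eq_bigr => B _; rewrite rhoM.
by move=> B B' _ _; case: gS => _ _ SU; apply: (can_inj (mulmxK (SU _ AS))).
Qed.

Lemma mean_fixl S p (X : 'M[C]_(N, p)) :
  mgroup S -> {in S, forall A, rho A *m X = X} -> mean S *m X = X.
Proof.
move=> gS SX; rewrite meanE -scalemxAl mulmx_suml (eq_bigr (fun=> X)) //.
by rewrite sumr_const -scaler_nat scalerA mulVf ?scale1r ?card_mgroup_neq0.
Qed.

Lemma mean_fixr S p (X : 'M[C]_(p, N)) :
  mgroup S -> {in S, forall A, X *m rho A = X} -> X *m mean S = X.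
Proof.
move=> gS SX; rewrite meanE -scalemxAr mulmx_sumr (eq_bigr (fun=> X)) //.
by rewrite sumr_const -scaler_nat scalerA mulVf ?scale1r ?card_mgroup_neq0.
Qed.

Lemma mean_subl S T : mgroup S -> mgroup T -> {subset S <= T} ->
  mean S *m mean T = mean T.
Proof. by move=> gS gT ST; apply: mean_fixl => // A /ST; apply: mean_mull. Qed.

Lemma mean_subr S T : mgroup S -> mgroup T -> {subset S <= T} ->
  mean T *m mean S = mean T.
Proof. by move=> gS gT ST; apply: mean_fixr => // A /ST; apply: mean_mulr. Qed.

(** Both sides equal m' g m, where m and m' are the averages over S and T: each
factor g A of g m is A' g with A' in T, which m' absorbs, and symmetrically. *)
Lemma mean_conj S T A B : mgroup S -> mgroup T -> A *m B = 1%:M ->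
  {in S, forall M, A *m M *m B \in T} -> {in T, forall M, B *m M *m A \in S} ->
  rho A *m mean S = mean T *m rho A.
Proof.
move=> gS gT AB ST TS; have BA := mulmx1C AB.
transitivity (mean T *m (rho A *m mean S)).
  apply/esym/mean_fixl => // M MT; rewrite mulmxA -rhoM.
  have -> : M *m A = A *m (B *m M *m A) by rewrite !mulmxA AB mul1mx.
  by rewrite rhoM -mulmxA mean_mull ?TS.
rewrite mulmxA; apply: mean_fixr => // M MS; rewrite -mulmxA -rhoM.
have -> : A *m M = A *m M *m B *m A by rewrite -!mulmxA BA mulmx1.
by rewrite rhoM mulmxA mean_mulr ?ST.
Qed.

Lemma mean_comm S X : {in S, forall A, rho A *m X = X *m rho A} ->
  mean S *m X = X *m mean S.
Proof.
move=> SX; rewrite !meanE -scalemxAl -scalemxAr mulmx_suml mulmx_sumr.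
by congr (_ *: _); apply: eq_bigr.
Qed.

Lemma mean_pattern_conj (w r r' : rel 'I_d) A B :
  mgroup (pattern F r) -> mgroup (pattern F r') ->
  A *m B = 1%:M -> supported w A -> supported w B ->
  (forall i a b j, w i a -> r a b -> w b j -> r' i j) ->
  (forall i a b j, w i a -> r' a b -> w b j -> r i j) ->
  rho A *m mean (pattern F r) = mean (pattern F r') *m rho A.
Proof.
move=> gr gr' AB wA wB rr' r'r; have BA := mulmx1C AB.
by apply: (mean_conj gr gr' AB) => M; apply: pattern_conj; eassumption.
Qed.

Lemma supported_pattern (r w : rel 'I_d) A :
  (forall i j, r i j -> w i j) -> reflexive w -> A \in pattern F r ->
  supported w A.
Proof.
move=> rw wr /patternP rA i j nw.
have := rA i j (contra (@rw i j) nw); rewrite !mxE => /eqP; rewrite subr_eq0.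
by move/eqP->; case: eqP nw => // ->; rewrite wr.
Qed.

(** The elements of a pattern group have inverses with the same support, so w
bounds the supports of both A and its inverse. *)
Lemma mean_pattern_norm (s r w : rel 'I_d) A :
  mgroup (pattern F s) -> mgroup (pattern F r) ->
  (forall i j, s i j -> w i j) -> reflexive w ->
  (forall i a b j, w i a -> r a b -> w b j -> r i j) ->
  A \in pattern F s ->
  rho A *m mean (pattern F r) = mean (pattern F r) *m rho A.
Proof.
move=> gs gr sw w1 wrw As; have [B [Bs AB _]] := mgroup_inv gs As.
by apply: (@mean_pattern_conj w _ _ _ B) => //; apply: supported_pattern sw _ _.
Qed.

End Means.

(** * Two-by-two matrices in a pair of coordinates *)

Section Embed.
Variables (F : finFieldType) (d : nat) (k l : 'I_d).
Hypothesis kl : k != l.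

Definition gl2 (a b c e : F) : 'M[F]_d :=
  1%:M + ((a - 1) *: delta_mx k k + b *: delta_mx k l
    + c *: delta_mx l k + (e - 1) *: delta_mx l l).

Lemma gl2M a b c e a' b' c' e' :
  gl2 a b c e *m gl2 a' b' c' e' =
  gl2 (a * a' + b * c') (a * b' + b * e') (c * a' + e * c') (c * b' + e * e').
Proof.
rewrite /gl2 !mulmxDl !mulmxDr !mul1mx !mulmx1 -!scalemxAl -!scalemxAr.
rewrite !mul_delta_mx_cond (eq_sym l k) (negPf kl) !eqxx !mulr1n !mulr0n.
by apply/matrixP=> i j; rewrite !mxE; ring.
Qed.

Lemma gl2_eq a b c e a' b' c' e' :
  a = a' -> b = b' -> c = c' -> e = e' -> gl2 a b c e = gl2 a' b' c' e'.
Proof. by move=> -> -> -> ->. Qed.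

Lemma gl2_1 : gl2 1 0 0 1 = 1%:M.
Proof. by rewrite /gl2 subrr !scale0r !addr0. Qed.

Lemma gl2E a b c e i j : gl2 a b c e i j =
  (i == j)%:R + ((a - 1) * ((i == k) && (j == k))%:R
   + b * ((i == k) && (j == l))%:R + c * ((i == l) && (j == k))%:R
   + (e - 1) * ((i == l) && (j == l))%:R).
Proof. by rewrite /gl2 !mxE. Qed.

Definition swap_rel : rel 'I_d := fun i j =>
  [|| (i == k) && (j == l), (i == l) && (j == k) |
      [&& i != k, i != l & i == j]].

Lemma supported_gl2_anti b c : supported swap_rel (gl2 0 b c 0).
Proof.
move=> i j; rewrite gl2E /swap_rel.
have [->|ik] := eqVneq i k.
  rewrite (negPf kl) /= orbF => /negPf->; rewrite (eq_sym k j).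
  by case: (j == k) => /=; ring.
have [->|il] := eqVneq i l.
  rewrite /= orbF => /negPf->; rewrite (eq_sym l j).
  by case: (j == l) => /=; ring.
by rewrite /= => /negPf->; rewrite /=; ring.
Qed.

Lemma supported_gl2_diag a e : supported (fun i j => i == j) (gl2 a 0 0 e).
Proof.
move=> i j ij; rewrite gl2E (negPf ij); move: ij.
have [->|_] := eqVneq i k.
  by rewrite eq_sym => /negPf->; rewrite (negPf kl) /=; ring.
by have [->|_] := eqVneq i l; rewrite 1?eq_sym => /negPf H; rewrite ?H /=; ring.
Qed.

End Embed.

Lemma mulmxZZ (K : comPzRingType) m n p (a b : K) (A : 'M[K]_(m, n))
    (B : 'M[K]_(n, p)) : (a *: A) *m (b *: B) = (a * b) *: (A *m B).
Proof. by rewrite -scalemxAl -scalemxAr scalerA. Qed.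

(** * The Jucys-Murphy elements and their commutation *)

Section Mirabolic.
Variables (F : finFieldType) (d : nat) (C : numFieldType) (N : nat).
Variable rho : 'M[F]_d -> 'M[C]_N.
Hypothesis rho1 : rho 1%:M = 1%:M.
Hypothesis rhoM : forall A B, rho (A *m B) = rho A *m rho B.

Local Notation q := (#|F|%:R : C).

Definition upper_rel : rel 'I_d := fun i j => (i < j)%N.
Definition row_rel (l : 'I_d) : rel 'I_d := fun i j => (i == l) && (j < l)%N.
Definition col_rel (l : 'I_d) : rel 'I_d := fun i j => (j == l) && (i < l)%N.
Definition corner_rel (l : nat) : rel 'I_d := fun i j => (i < j < l)%N.
Definition beyond_rel (l : nat) : rel 'I_d := fun i j => (i < j)%N && (l < j)%N.
Definition entry_rel (k l : 'I_d) : rel 'I_d := fun i j => (i == k) && (j == l).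
Definition short_row_rel (k l : 'I_d) : rel 'I_d :=
  fun i j => (i == l) && (j < k)%N.
(** For adjacent k and l this is the unipotent radical of the minimal parabolic
subgroup that contains the GL_2 of the coordinates k, l. *)
Definition nil_rel (k l : 'I_d) : rel 'I_d :=
  fun i j => (i < j)%N && ~~ entry_rel k l i j.

Local Notation "<< r >>" := (mean rho (pattern F r)).

Lemma mgroup_upper : mgroup (pattern F upper_rel).
Proof. by apply: pattern_group; [move=> ? ? ?; apply: ltn_trans | left]. Qed.

(* Unfolds the index relations into arithmetic on the values of the indices. *)
Ltac rels := rewrite /nil_rel /upper_rel /row_rel /col_rel /corner_rel
  /beyond_rel /entry_rel /short_row_rel /swap_rel -?(inj_eq (@ord_inj d)) /=;
  try lia.

Lemma mgroup_row l : mgroup (pattern F (row_rel l)).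
Proof. by apply: pattern_group; [move=> a b c | right=> a b]; rels. Qed.
Lemma mgroup_col l : mgroup (pattern F (col_rel l)).
Proof. by apply: pattern_group; [move=> a b c | left=> a b]; rels. Qed.
Lemma mgroup_corner l : mgroup (pattern F (corner_rel l)).
Proof. by apply: pattern_group; [move=> a b c | left=> a b]; rels. Qed.
Lemma mgroup_beyond l : mgroup (pattern F (beyond_rel l)).
Proof. by apply: pattern_group; [move=> a b c | left=> a b]; rels. Qed.
Lemma mgroup_short_row (k l : 'I_d) :
  (k < l)%N -> mgroup (pattern F (short_row_rel k l)).
Proof.
by move=> kl; apply: pattern_group; [move=> a b c | right=> a b]; rels.
Qed.
Lemma mgroup_entry_up (k l : 'I_d) :
  (k < l)%N -> mgroup (pattern F (entry_rel k l)).
Proof.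
by move=> kl; apply: pattern_group; [move=> a b c | left=> a b]; rels.
Qed.
Lemma mgroup_entry_low (k l : 'I_d) :
  (k < l)%N -> mgroup (pattern F (entry_rel l k)).
Proof.
by move=> kl; apply: pattern_group; [move=> a b c | right=> a b]; rels.
Qed.
Lemma mgroup_nil (k l : 'I_d) :
  l = k.+1 :> nat -> mgroup (pattern F (nil_rel k l)).
Proof.
by move=> kl; apply: pattern_group; [move=> a b c | left=> a b]; rels.
Qed.

Let e := << upper_rel >>.

Lemma mean_upper_idem : e *m e = e.
Proof. by apply: mean_subl => //; apply: mgroup_upper. Qed.

Lemma pattern_sub (r r' : rel 'I_d) : (forall i j, r i j -> r' i j) ->
  {subset pattern F r <= pattern F r'}.
Proof.
move=> rr A /patternP rA; apply/patternP=> i j nr; apply: rA.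
by apply: contra nr; apply: rr.
Qed.

Lemma mean_upper_mull r : mgroup (pattern F r) ->
  (forall i j, r i j -> upper_rel i j) -> <<r>> *m e = e.
Proof.
by move=> gr rr; apply: mean_subl (pattern_sub rr) => //; apply: mgroup_upper.
Qed.

Lemma mean_upper_mulr r : mgroup (pattern F r) ->
  (forall i j, r i j -> upper_rel i j) -> e *m <<r>> = e.
Proof.
by move=> gr rr; apply: mean_subr (pattern_sub rr) => //; apply: mgroup_upper.
Qed.

(** Cut the columns of A - 1 at column l: a position (i, a) with l < a cannot be
followed by a position (a, j) with j <= l, because a < j. *)
Lemma upper_split (l : 'I_d) A : A \in pattern F upper_rel -> exists M c g,
  [/\ M \in pattern F (beyond_rel l), c \in pattern F (col_rel l),
      g \in pattern F (corner_rel l) & A = M *m c *m g].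
Proof.
move=> UA.
have [||| M [A' [UM UA' ->]]] := @pattern_split F d _ (beyond_rel l)
  (fun i j => (i < j)%N && (j <= l)%N) A _ _ _ UA; try by move=> i j; rels.
have [||| c [g [Uc Ug ->]]] := @pattern_split F d _ (col_rel l)
  (corner_rel l) A' _ _ _ UA'; try by move=> i j; rels.
by exists M, c, g; rewrite mulmxA.
Qed.

(** Up to a power of q, the Radon element of GL_(l+1), acting on the first l + 1
coordinates.  Like the average over row l it commutes with GL_l, and moreover e
passes through it. *)
Definition radon_block (l : 'I_d) : 'M[C]_N :=
  locked (<<col_rel l>> *m <<row_rel l>> *m <<col_rel l>>).

(** The group GL_l of the first l coordinates normalizes both the column group
and the row group. *)
Lemma radon_block_corner (s : rel 'I_d) (l : 'I_d) A :
  mgroup (pattern F s) -> (forall i j, s i j -> (i < l)%N && (j < l)%N) ->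
  A \in pattern F s -> rho A *m radon_block l = radon_block l *m rho A.
Proof.
move=> gs sl sA.
pose w : rel 'I_d := fun i j => (i == j) || (i < l)%N && (j < l)%N.
have sw i j : s i j -> w i j by move/sl; rewrite /w orbC => ->.
have w1 : reflexive w by move=> i; rewrite /w eqxx.
have Ac : rho A *m <<col_rel l>> = <<col_rel l>> *m rho A.
  apply: (@mean_pattern_norm _ _ _ _ _ rhoM s (col_rel l) w) => //.
    exact: mgroup_col.
  by move=> i a b j; rewrite /w; rels.
have Ar : rho A *m <<row_rel l>> = <<row_rel l>> *m rho A.
  apply: (@mean_pattern_norm _ _ _ _ _ rhoM s (row_rel l) w) => //.
    exact: mgroup_row.
  by move=> i a b j; rewrite /w; rels.
rewrite /radon_block -lock !mulmxA Ac -(mulmxA _ _ <<row_rel l>>) Ar.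
by rewrite -!mulmxA Ac.
Qed.

(** GL_(l+1) normalizes the unipotent radical formed by the columns after l. *)
Lemma radon_block_beyond (l : 'I_d) :
  radon_block l *m <<beyond_rel l>> = <<beyond_rel l>> *m radon_block l.
Proof.
pose w : rel 'I_d := fun i j => (i == j) || (i <= l)%N && (j <= l)%N.
have comm s : mgroup (pattern F s) ->
    (forall i j, s i j -> (i <= l)%N && (j <= l)%N) ->
    <<s>> *m <<beyond_rel l>> = <<beyond_rel l>> *m <<s>>.
  move=> gs sl; apply: mean_comm => A sA.
  have sw i j : s i j -> w i j by move/sl; rewrite /w orbC => ->.
  have w1 : reflexive w by move=> i; rewrite /w eqxx.
  apply: (@mean_pattern_norm _ _ _ _ _ rhoM s (beyond_rel l) w) => //.
    exact: mgroup_beyond.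
  by move=> i a b j; rewrite /w; rels.
have Ac : <<col_rel l>> *m <<beyond_rel l>> = <<beyond_rel l>> *m <<col_rel l>>.
  by apply: comm (mgroup_col l) _ => i j; rels.
have Ar : <<row_rel l>> *m <<beyond_rel l>> = <<beyond_rel l>> *m <<row_rel l>>.
  by apply: comm (mgroup_row l) _ => i j; rels.
by rewrite /radon_block -lock -!mulmxA Ac (mulmxA <<row_rel l>>) Ar !mulmxA Ac.
Qed.

Lemma radon_block_mean_corner (s : rel 'I_d) (l : 'I_d) :
  mgroup (pattern F s) -> (forall i j, s i j -> (i < l)%N && (j < l)%N) ->
  <<s>> *m radon_block l = radon_block l *m <<s>>.
Proof. by move=> gs sl; apply: mean_comm => A; apply: radon_block_corner. Qed.

(** An element of U is a product M c g as in [upper_split].  On the right of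
e radon_block, c is absorbed by the block, while M and g pass through the block
and are absorbed by e. *)
Lemma radon_block_fixr (l : 'I_d) :
  e *m radon_block l *m e = e *m radon_block l.
Proof.
apply: mean_fixr => [|A]; first exact: mgroup_upper.
case/(upper_split l)=> M [c [g [UM Uc Ug ->]]]; rewrite !rhoM !mulmxA.
have -> : e *m radon_block l *m rho M = e *m radon_block l.
  rewrite -{1}(@mean_upper_mulr (beyond_rel l)); last 2 first.
  - exact: mgroup_beyond.
  - by move=> i j; rels.
  rewrite -(mulmxA e) -radon_block_beyond !mulmxA -(mulmxA _ _ (rho M)).
  rewrite mean_mulr //; last exact: mgroup_beyond.
  rewrite -(mulmxA e) radon_block_beyond mulmxA mean_upper_mulr //.
    exact: mgroup_beyond.
  by move=> i j; rels.
have -> : e *m radon_block l *m rho c = e *m radon_block l.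
  by rewrite /radon_block -lock -!mulmxA mean_mulr //; exact: mgroup_col.
rewrite -mulmxA -(@radon_block_corner (corner_rel l)) //; last 2 first.
- exact: mgroup_corner.
- by move=> i j; rels.
rewrite mulmxA mean_mulr //; first exact: mgroup_upper.
by apply: pattern_sub Ug => i j; rels.
Qed.

Lemma radon_block_fixl (l : 'I_d) :
  e *m radon_block l *m e = radon_block l *m e.
Proof.
rewrite -mulmxA; apply: mean_fixl => [|A]; first exact: mgroup_upper.
case/(upper_split l)=> M [c [g [UM Uc Ug ->]]].
rewrite !rhoM !mulmxA -(mulmxA _ _ (radon_block l)).
rewrite (@radon_block_corner (corner_rel l)) //; last 2 first.
- exact: mgroup_corner.
- by move=> i j; rels.
rewrite -!mulmxA mean_mull //; [|exact: mgroup_upper|]; last first.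
  by apply: pattern_sub Ug => i j; rels.
have -> : rho c *m (radon_block l *m e) = radon_block l *m e.
  by rewrite /radon_block -lock !mulmxA mean_mull //; exact: mgroup_col.
have Ze : radon_block l *m e = <<beyond_rel l>> *m (radon_block l *m e).
  rewrite mulmxA -radon_block_beyond -mulmxA mean_upper_mull //.
    exact: mgroup_beyond.
  by move=> i j; rels.
by rewrite Ze mulmxA mean_mull //; exact: mgroup_beyond.
Qed.

Lemma radon_blockE (l : 'I_d) :
  e *m radon_block l *m e = e *m <<row_rel l>> *m e.
Proof.
rewrite /radon_block -lock !mulmxA mean_upper_mulr; last 2 first.
- exact: mgroup_col.
- by move=> i j; rels.
rewrite -mulmxA mean_upper_mull //; first exact: mgroup_col.
by move=> i j; rels.
Qed.

Definition jucys_murphy (l : 'I_d) : 'M[C]_N :=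
  q ^+ (2 * l) *: (e *m <<row_rel l>> *m e).

(** The row group of k lies in the GL_l that commutes with the block of l, and e
moves freely across that block. *)
Lemma jucys_murphy_comm (k l : 'I_d) : (k < l)%N ->
  jucys_murphy k *m jucys_murphy l = jucys_murphy l *m jucys_murphy k.
Proof.
move=> kl; rewrite /jucys_murphy !mulmxZZ mulrC; congr (_ *: _).
rewrite -(radon_blockE l).
set y := <<row_rel k>>.
have comm : y *m radon_block l = radon_block l *m y.
  by apply: radon_block_mean_corner; [exact: mgroup_row | move=> i j; rels].
transitivity (e *m (y *m radon_block l) *m e).
  rewrite radon_block_fixl -!mulmxA (mulmxA e (radon_block l)).
  by rewrite radon_block_fixl.
rewrite comm (mulmxA e) -radon_block_fixr -!mulmxA; congr (_ *m (_ *m _)).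
by do 2!rewrite (mulmxA e e) mean_upper_idem.
Qed.

(** * Adjacent coordinates: recursion and quadratic relation *)

Section Adjacent.
Variables k l : 'I_d.
Hypothesis kl : l = k.+1 :> nat.

Let ltkl : (k < l)%N. Proof. by rewrite kl. Qed.
Let nekl : k != l. Proof. by rewrite -val_eqE neq_ltn ltkl. Qed.

Let g := @gl2 F d k l.
Let s : 'M[C]_N := locked (rho (g 0 (-1) 1 0)).
Let s' : 'M[C]_N := locked (rho (g 0 1 (-1) 0)).
Let xp := <<entry_rel k l>>.
Let xm := <<entry_rel l k>>.
Let nl := <<nil_rel k l>>.

Let sE : s = rho (g 0 (-1) 1 0). Proof. by rewrite /s -lock. Qed.
Let s'E : s' = rho (g 0 1 (-1) 0). Proof. by rewrite /s' -lock. Qed.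

Let ss' : g 0 (-1) 1 0 *m g 0 1 (-1) 0 = 1%:M.
Proof. by rewrite /g gl2M // -[RHS](gl2_1 F k l); apply: gl2_eq; ring. Qed.
Let s's : g 0 1 (-1) 0 *m g 0 (-1) 1 0 = 1%:M.
Proof. exact: mulmx1C ss'. Qed.

Lemma s_inv : s *m s' = 1%:M. Proof. by rewrite sE s'E -rhoM ss' rho1. Qed.

Let gnl := mgroup_nil kl.
Let gxp := mgroup_entry_up ltkl.
Let gxm := mgroup_entry_low ltkl.

Let swap_s := supported_gl2_anti nekl (-1 : F) 1.
Let swap_s' := supported_gl2_anti nekl (1 : F) (-1).

Lemma s_nl : s *m nl = nl *m s.
Proof.
rewrite sE; apply: (mean_pattern_conj rhoM gnl gnl ss' swap_s swap_s')
  => i a b j; rels.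
Qed.

Lemma s'_nl : s' *m nl = nl *m s'.
Proof.
rewrite s'E; apply: (mean_pattern_conj rhoM gnl gnl s's swap_s' swap_s)
  => i a b j; rels.
Qed.

Lemma xm_nl : xm *m nl = nl *m xm.
Proof.
apply: mean_comm => A; pose w : rel 'I_d := fun i j =>
  (i == j) || ((i == k) || (i == l)) && ((j == k) || (j == l)).
apply: (@mean_pattern_norm _ _ _ _ _ rhoM _ _ w) => //.
- by move=> i j; rewrite /w; rels.
- by move=> i; rewrite /w eqxx.
- by move=> i a b j; rewrite /w; rels.
Qed.

Lemma s_xp : s *m xp = xm *m s.
Proof.
rewrite sE; apply: (mean_pattern_conj rhoM gxp gxm ss' swap_s swap_s')
  => i a b j; rels.
Qed.

Lemma s'_xm : s' *m xm = xp *m s'.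
Proof.
rewrite s'E; apply: (mean_pattern_conj rhoM gxm gxp s's swap_s' swap_s)
  => i a b j; rels.
Qed.

(** U is generated by the root subgroup of the entry (k, l) and by the radical
[nil_rel]. *)
Lemma upper_ind (P : 'M[F]_d -> Prop) :
  (forall A B, P A -> P B -> P (A *m B)) ->
  {in pattern F (nil_rel k l), forall A, P A} ->
  {in pattern F (entry_rel k l), forall A, P A} ->
  {in pattern F upper_rel, forall A, P A}.
Proof.
move=> PM Pn Px A /(upper_split l)[M [c [b [UM Uc Ub ->]]]].
have [|||c1 [c2 [Uc1 Uc2 ->]]] := @pattern_split F d _
   (fun i j => (j == l) && (i < k)%N) (entry_rel k l) c _ _ _ Uc;
  try by move=> i j; rels.
apply: (PM); first (apply: (PM); last apply: (PM)).
- by apply: Pn; apply: pattern_sub UM => i j; rels.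
- by apply: Pn; apply: pattern_sub Uc1 => i j; rels.
- exact: Px.
- by apply: Pn; apply: pattern_sub Ub => i j; rels.
Qed.

Let nl_e : nl *m e = e.
Proof. by apply: mean_upper_mull => // i j; rels. Qed.
Let e_nl : e *m nl = e.
Proof. by apply: mean_upper_mulr => // i j; rels. Qed.
Let xp_e : xp *m e = e.
Proof. by apply: mean_upper_mull => // i j; rels. Qed.
Let e_xp : e *m xp = e.
Proof. by apply: mean_upper_mulr => // i j; rels. Qed.

(** s U s^-1 is the product of the radical and of the opposite root subgroup, so
that e (s e s^-1) = e xm.  In terms of absorption: e xm s = e s xp absorbs the
root subgroup on the right, and it absorbs the radical because xm and s
normalize it. *)
Lemma ese : e *m s *m e = e *m xm *m s.
Proof.
have <- : e *m xm *m s *m e = e *m s *m e.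
  by rewrite -(mulmxA e) -s_xp -!mulmxA xp_e.
apply: mean_fixr; first exact: mgroup_upper.
apply: upper_ind => [A B PA PB|A nA|A xA]; first by rewrite rhoM mulmxA PA PB.
  have <- : e *m xm *m s *m nl = e *m xm *m s.
    by rewrite -mulmxA s_nl mulmxA -(mulmxA e) xm_nl !mulmxA e_nl.
  by rewrite -mulmxA mean_mulr.
by rewrite -(mulmxA e) -s_xp mulmxA -mulmxA mean_mulr.
Qed.

Lemma es'e : e *m s' *m e = s' *m xm *m e.
Proof.
have <- : e *m (s' *m xm *m e) = e *m s' *m e.
  by rewrite s'_xm !mulmxA e_xp.
apply: mean_fixl; first exact: mgroup_upper.
apply: upper_ind => [A B PA PB|A nA|A xA]; first by rewrite rhoM -mulmxA PB PA.
  have <- : nl *m (s' *m xm *m e) = s' *m xm *m e.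
    by rewrite !mulmxA -s'_nl -(mulmxA s') -xm_nl -!mulmxA nl_e.
  by rewrite mulmxA mean_mull.
by rewrite s'_xm !mulmxA mean_mull.
Qed.

Let y' := <<short_row_rel k l>>.
Let gy' := mgroup_short_row ltkl.

Lemma s_row : s *m <<row_rel k>> = y' *m s.
Proof.
rewrite sE.
apply: (mean_pattern_conj rhoM (mgroup_row k) gy' ss' swap_s swap_s')
  => i a b j; rels.
Qed.

(** xm and y' are averages over commuting subgroups with product the row group
of l. *)
Lemma row_split : xm *m y' *m xm = <<row_rel l>>.
Proof.
have xmy A : A \in pattern F (short_row_rel k l) -> rho A *m xm = xm *m rho A.
  pose w : rel 'I_d := fun i j => (i == j) || (i == l) && (j < k)%N.
  apply: (@mean_pattern_norm _ _ _ _ _ rhoM _ _ w) => //.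
  - by move=> i j; rewrite /w; rels.
  - by move=> i; rewrite /w eqxx.
  - by move=> i a b j; rewrite /w; rels.
have fix1 : <<row_rel l>> *m (xm *m y' *m xm) = <<row_rel l>>.
  have rxm : <<row_rel l>> *m xm = <<row_rel l>>.
    apply: mean_subr => //; first exact: mgroup_row.
    by apply: pattern_sub => i j; rels.
  have ry' : <<row_rel l>> *m y' = <<row_rel l>>.
    apply: mean_subr => //; first exact: mgroup_row.
    by apply: pattern_sub => i j; rels.
  by rewrite !mulmxA rxm ry' rxm.
rewrite -{}fix1; apply/esym/mean_fixl => [|A rA]; first exact: mgroup_row.
have [|||b [c [Ub Uc ->]]] := @pattern_split F d _ (entry_rel l k)
   (short_row_rel k l) A _ _ _ rA; try by move=> i j; rels.
rewrite rhoM !mulmxA -(mulmxA (rho b)) xmy // -!mulmxA (mulmxA (rho c)).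
rewrite mean_mull //.
by rewrite mulmxA mean_mull.
Qed.

(** The images of the double cosets U s U and U s^-1 U in the Hecke algebra. *)
Definition hecke_T := locked (q *: (e *m s *m e)).
Definition hecke_Ts := locked (q *: (e *m s' *m e)).
Let TE : hecke_T = q *: (e *m s *m e).
Proof. by rewrite /hecke_T -lock. Qed.
Let TsE : hecke_Ts = q *: (e *m s' *m e).
Proof. by rewrite /hecke_Ts -lock. Qed.

(** By [ese] and [es'e], T J_k T* is a power of q times e xm (s y_k s^-1) xm e.
Conjugation by s moves row k to row l, and xm fills in the missing entry
(l, k). *)
Lemma jucys_murphy_step :
  jucys_murphy l = hecke_T *m jucys_murphy k *m hecke_Ts.
Proof.
rewrite TE TsE /jucys_murphy !mulmxZZ; congr (_ *: _).
  by rewrite kl mulnS addnC exprD expr2 mulrA (mulrC q (q ^+ _)).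
have esee X : e *m s *m e *m (e *m X) = e *m s *m e *m X.
  by rewrite mulmxA -(mulmxA (e *m s)) mean_upper_idem.
have e_es' X : X *m e *m (e *m s' *m e) = X *m (e *m s' *m e).
  by rewrite !mulmxA -(mulmxA X e e) mean_upper_idem.
rewrite -(mulmxA e <<row_rel k>> e) esee (mulmxA _ _ e) e_es' ese es'e.
rewrite -(mulmxA _ s) s_row !mulmxA -(mulmxA _ s s') s_inv mulmx1.
by rewrite -row_split !mulmxA.
Qed.

Definition torus : {set 'M[F]_d} := [set g c^-1 0 0 c | c in [set~ 0]].
Let E := mean rho torus.

Let inj_torus : {in [set~ 0] &, injective (fun c => g c^-1 0 0 c)}.
Proof.
move=> c c' _ _ /matrixP/(_ l l); rewrite !gl2E eq_sym (negPf nekl) !eqxx /=.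
by rewrite !mulr0 !mulr1 !add0r !(addrC 1) !subrK.
Qed.

Lemma mgroup_torus : mgroup torus.
Proof.
have hM c c' : g c^-1 0 0 c *m g c'^-1 0 0 c' = g (c * c')^-1 0 0 (c * c').
  by rewrite /g gl2M // invfM; apply: gl2_eq; ring.
have h1 : 1%:M = g 1^-1 0 0 1 by rewrite invr1 /g gl2_1.
split=> [|_ _ /imsetP[c c0 ->] /imsetP[c' c'0 ->]|_ /imsetP[c c0 ->]].
- by rewrite h1; apply/imset_f; rewrite !inE oner_eq0.
- by rewrite hM; apply/imset_f; rewrite !inE mulf_neq0 // -in_setC1.
rewrite !inE in c0.
suff: g c^-1 0 0 c *m g c^-1^-1 0 0 c^-1 = 1%:M by case/mulmx1_unit.
by rewrite hM mulfV // h1.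
Qed.

Lemma card_torus : #|torus|%:R = q - 1.
Proof.
rewrite card_in_imset // cardsC1 -subn1 natrB //.
by apply/card_gt0P; exists 0.
Qed.

Let diag_h (a b : F) := supported_gl2_diag nekl a b.
Let h_inv c : c != 0 -> g c^-1 0 0 c *m g c 0 0 c^-1 = 1%:M.
Proof.
move=> c0; rewrite /g gl2M // -[RHS](gl2_1 F k l).
by apply: gl2_eq; rewrite ?mulVf ?mulfV //; ring.
Qed.

Lemma torus_pattern (r : rel 'I_d) A : mgroup (pattern F r) -> A \in torus ->
  rho A *m <<r>> = <<r>> *m rho A.
Proof.
move=> gr /imsetP[c]; rewrite !inE => c0 ->.
by apply: (mean_pattern_conj rhoM gr gr (h_inv c0) (diag_h _ _) (diag_h _ _))
  => i a b j /eqP-> ? /eqP<-.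
Qed.

Let E_pattern (r : rel 'I_d) : mgroup (pattern F r) -> E *m <<r>> = <<r>> *m E.
Proof. by move=> gr; apply: mean_comm => A; apply: torus_pattern. Qed.
Lemma torus_mean_upper : E *m e = e *m E.
Proof. exact: E_pattern mgroup_upper. Qed.

Let torus_swap (b : F) : b * b = 1 -> forall A, A \in torus ->
  g 0 (- b) b 0 *m A *m g 0 b (- b) 0 \in torus.
Proof.
move=> bb _ /imsetP[c c0 ->].
have -> : g 0 (- b) b 0 *m g c^-1 0 0 c *m g 0 b (- b) 0 = g c^-1^-1 0 0 c^-1.
  rewrite /g !gl2M // invrK; apply: gl2_eq; rewrite ?bb; try by ring.
    by transitivity (b * b * c); [ring | rewrite bb mul1r].
  by transitivity (b * b * c^-1); [ring | rewrite bb mul1r].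
by apply/imset_f; move: c0; rewrite !inE invr_eq0.
Qed.

Let E_s : E *m s = s *m E.
Proof.
rewrite sE; apply/esym/(mean_conj rhoM mgroup_torus mgroup_torus ss') => A At.
  by apply: torus_swap; rewrite ?mulr1.
by have := torus_swap (b := -1); rewrite opprK; apply; rewrite // mulrNN mulr1.
Qed.

(* s^-1 = hm s, and hm is central in GL_2; hence T* = hm T. *)
Let hm := g (-1) 0 0 (-1).
Let hm_torus : hm \in torus.
Proof.
by apply/imsetP; exists (-1); rewrite ?inE ?oppr_eq0 ?oner_eq0 // invrN invr1.
Qed.
Let s'_hm : s' = rho hm *m s.
Proof.
by rewrite s'E sE -rhoM /hm /g gl2M //; congr rho; apply: gl2_eq; ring.
Qed.
Let s_hm : s *m rho hm = rho hm *m s.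
Proof.
by rewrite sE -!rhoM /hm /g !gl2M //; congr rho; apply: gl2_eq; ring.
Qed.
Let e_hm : rho hm *m e = e *m rho hm.
Proof. exact: torus_pattern mgroup_upper hm_torus. Qed.
Let E_hm : E *m rho hm = E.
Proof. by apply: mean_mulr mgroup_torus hm_torus. Qed.

Let Ts_hm : hecke_Ts = rho hm *m hecke_T.
Proof.
by rewrite TE TsE -scalemxAr s'_hm !mulmxA e_hm.
Qed.
Let T_hm : hecke_T *m rho hm = rho hm *m hecke_T.
Proof.
rewrite TE -scalemxAr -scalemxAl -!mulmxA -e_hm (mulmxA s) s_hm.
by rewrite !mulmxA e_hm.
Qed.

Lemma hecke_T_mulr : hecke_T *m e = hecke_T.
Proof. by rewrite TE -scalemxAl -mulmxA mean_upper_idem. Qed.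

Lemma torus_mean_T : E *m hecke_T = hecke_T *m E.
Proof.
rewrite TE -scalemxAl -scalemxAr !mulmxA torus_mean_upper -(mulmxA e E s) E_s.
by rewrite -!mulmxA torus_mean_upper.
Qed.

Lemma torus_mean_Ts : E *m hecke_Ts = E *m hecke_T.
Proof. by rewrite Ts_hm mulmxA E_hm. Qed.

Lemma torus_mean_Ts_comm : E *m hecke_Ts = hecke_Ts *m E.
Proof.
rewrite torus_mean_Ts torus_mean_T Ts_hm -T_hm -mulmxA; congr (_ *m _).
by apply/esym; apply: mean_mull mgroup_torus hm_torus.
Qed.

Lemma torus_mean_idem : E *m E = E.
Proof. by apply: mean_subl => //; apply: mgroup_torus. Qed.

Lemma torus_mean_jucys_murphy : E *m jucys_murphy k = jucys_murphy k *m E.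
Proof.
rewrite /jucys_murphy -scalemxAl -scalemxAr !mulmxA torus_mean_upper.
rewrite -(mulmxA e E _) E_pattern; last exact: mgroup_row.
by rewrite -!mulmxA torus_mean_upper.
Qed.

Lemma hecke_Ts_T : hecke_Ts *m hecke_T = hecke_T *m hecke_Ts.
Proof. by rewrite Ts_hm [RHS]mulmxA T_hm. Qed.

Let xmE : pattern F (entry_rel l k) = [set g 1 0 c 1 | c in setT].
Proof.
apply/setP=> A; apply/patternP/imsetP=> [rA|[c _ ->] i j].
  exists (A l k); rewrite ?inE //; apply/matrixP=> i j; rewrite gl2E.
  have := rA i j; rewrite /entry_rel !mxE subrr !mul0r add0r.
  case: (eqVneq i l) => [->|_]; case: (eqVneq j k) => [->|_] /= nr.
  - by rewrite eq_sym (negPf nekl) /=; ring.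
  - by have /eqP := nr isT; rewrite subr_eq0 => /eqP->; ring.
  - by have /eqP := nr isT; rewrite subr_eq0 => /eqP->; ring.
  - by have /eqP := nr isT; rewrite subr_eq0 => /eqP->; ring.
by rewrite /g /gl2 addrC addKr !mxE /entry_rel => /negPf->; rewrite /=; ring.
Qed.

Let xm_sum : q *: xm = rho 1%:M + \sum_(c in [set~ 0]) rho (g 1 0 c 1).
Proof.
have inj : {in setT &, injective (fun c => g 1 0 c 1)}.
  move=> c c' _ _ /matrixP/(_ l k); rewrite !gl2E eq_sym (negPf nekl) !eqxx /=.
  by rewrite !mulr0 !mulr1 !add0r !addr0.
have -> : q = #|pattern F (entry_rel l k)|%:R.
  by rewrite xmE card_in_imset // cardsT.
rewrite mean_sum // xmE big_imset //= (bigD1 0) //= /g gl2_1; congr (_ + _).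
by apply: eq_bigl => c; rewrite !inE.
Qed.

Let e_xm_e c : c != 0 ->
  e *m rho (g 1 0 c 1) *m e = rho (g c^-1 0 0 c) *m (e *m s *m e).
Proof.
move=> c0; have xU a : g 1 a 0 1 \in pattern F upper_rel.
  apply/patternP=> i j; rewrite /g /gl2 addrC addKr !mxE.
  have [->|_] := eqVneq i k; last by move=> _; rewrite /=; ring.
  have [->|_] := eqVneq j l; first by rewrite /upper_rel ltkl.
  by move=> _; rewrite /=; ring.
(* The Bruhat decomposition of a lower unitriangular matrix of SL_2. *)
have -> : g 1 0 c 1 =
    g 1 c^-1 0 1 *m (g c^-1 0 0 c *m g 0 (-1) 1 0) *m g 1 c^-1 0 1.
  by rewrite /g !gl2M //; apply: gl2_eq; field.
rewrite !rhoM !mulmxA mean_mulr //; last exact: mgroup_upper.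
rewrite -(mulmxA _ _ e) mean_mull //; last exact: mgroup_upper.
rewrite -sE -torus_pattern //; first exact: mgroup_upper.
by apply: imset_f; rewrite !inE.
Qed.

(** T T* = q^2 e xm e, and q xm is the sum of the lower root subgroup: its
identity element gives q e, and by the Bruhat decomposition in SL_2 each of the
others gives an element of the torus times T. *)
Lemma hecke_quadratic :
  hecke_T *m hecke_Ts = q *: e + (q - 1) *: (E *m hecke_T).
Proof.
have -> : hecke_T *m hecke_Ts = q *: (e *m (q *: xm) *m e).
  rewrite TE TsE mulmxZZ -scalemxAr -scalemxAl scalerA; congr (_ *: _).
  rewrite ese es'e !mulmxA -(mulmxA _ s s') s_inv mulmx1 -(mulmxA e xm xm).
  by rewrite mean_subl.
rewrite xm_sum mulmxDr mulmxDl rho1 mulmx1 mean_upper_idem scalerDr.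
congr (_ + _).
rewrite -card_torus (scalemxAl _ E) mean_sum; last exact: mgroup_torus.
rewrite big_imset //= TE -scalemxAr mulmx_sumr !mulmx_suml; congr (_ *: _).
by apply: eq_bigr => c; rewrite !inE => /e_xm_e.
Qed.

Lemma jucys_murphy_mull (j : 'I_d) : e *m jucys_murphy j = jucys_murphy j.
Proof. by rewrite /jucys_murphy -scalemxAr !mulmxA mean_upper_idem. Qed.
Lemma jucys_murphy_mulr (j : 'I_d) : jucys_murphy j *m e = jucys_murphy j.
Proof. by rewrite /jucys_murphy -scalemxAl -mulmxA mean_upper_idem. Qed.

End Adjacent.

Lemma jucys_murphy0 (l : 'I_d) : l = 0 :> nat -> jucys_murphy l = e.
Proof.
move=> l0; rewrite /jucys_murphy l0 expr0 scale1r.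
have -> : <<row_rel l>> = 1%:M; last by rewrite mulmx1 mean_upper_idem.
rewrite meanE.
have -> : pattern F (row_rel l) = [set 1%:M].
  apply/setP=> A; rewrite in_set1.
  apply/patternP/eqP=> [rA|-> i j _]; last first.
    by rewrite !mxE subrr.
  apply/matrixP=> i j; have := rA i j; rewrite /row_rel l0 ltn0 andbF !mxE.
  by move/(_ isT)/eqP; rewrite subr_eq0 => /eqP.
by rewrite cards1 invr1 scale1r big_set1 rho1.
Qed.

End Mirabolic.

(** * Eigenvalues of the Jucys-Murphy elements *)

Section Eigenvalues.
Variables (F : finFieldType) (d : nat) (C : numClosedFieldType) (N : nat).
Variable rho : 'M[F]_d -> 'M[C]_N.
Hypothesis rho1 : rho 1%:M = 1%:M.
Hypothesis rhoM : forall A B, rho (A *m B) = rho A *m rho B.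

Local Notation q := (#|F|%:R : C).
Local Notation e := (mean rho (pattern F (@upper_rel d))).

Lemma card_finField_neq0 : q != 0.
Proof. by rewrite pnatr_eq0 -lt0n; apply/card_gt0P; exists 0. Qed.

Lemma jucys_murphy_eigenvalue (l : 'I_d) (b : C) (v : 'rV[C]_N) :
  v != 0 -> v *m e = v -> v *m jucys_murphy rho l = b *: v ->
  exists2 j, (j <= 2 * l)%N & b = q ^+ j.
Proof.
case: l => m md; elim: m md b v => [|m IH] md b v v0 ve vb.
  exists 0 => //; move: vb; rewrite (jucys_murphy0 rho1 rhoM) // ve.
  move=> /esym/eqP.
  rewrite -subr_eq0 -{2}(scale1r v) -scalerBl scaler_eq0 (negPf v0) orbF.
  by rewrite subr_eq0 => /eqP.
pose l := Ordinal md; pose k := Ordinal (ltnW md).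
have kl : l = k.+1 :> nat by [].
have jl := jucys_murphy_step rho1 rhoM kl.
have [a [w [w0 we wa bE]]] : exists a (w : 'rV[C]_N),
    [/\ w != 0, w *m e = w, w *m jucys_murphy rho k = a *: w &
     [\/ b = a, b = q * a | b = q ^+ 2 * a]].
  apply: (@hecke_eigenvalue_step _ _ q b e (mean rho (torus F k l))
    (jucys_murphy rho k) (hecke_T rho k l) (hecke_Ts rho k l) v) => //.
  - exact: card_finField_neq0.
  - exact: jucys_murphy_mull.
  - exact: jucys_murphy_mulr.
  - exact: hecke_T_mulr.
  - exact: torus_mean_idem.
  - exact: torus_mean_upper.
  - exact: torus_mean_jucys_murphy.
  - exact: torus_mean_T.
  - exact: torus_mean_Ts.
  - exact: hecke_quadratic.
  - by rewrite hecke_Ts_T //; exact: hecke_quadratic.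
  - by rewrite -jl; exact: jucys_murphy_comm.
  - exact: torus_mean_Ts_comm.
  - by rewrite -jl.
have [j jk aE] := IH _ a w w0 we wa.
case: bE => ->; rewrite aE -?exprS -?exprD.
- by exists j; rewrite //= (leq_trans jk) // leq_mul2l ltnW.
- by exists j.+1; rewrite //=; move: jk => /=; lia.
- by exists (2 + j)%N; rewrite //=; move: jk => /=; lia.
Qed.

End Eigenvalues.

(** * The regular representation and the Radon element *)

Section Bridge.
Variables (F : finFieldType) (n : nat) (C : numClosedFieldType).
Local Notation G := 'GL_n[F]%G.
Local Notation aG := (regular_repr C G).

(** Extending the regular representation by 0 to the singular matrices keeps it
multiplicative, since a product is invertible only if both factors are. *)
Definition regular_mx_on (A : 'M[F]_n.-1.+1) : 'M[C]_#|G| :=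
  if insub A is Some x then aG (x : {'GL_n[F]}) else 0.

Lemma regular_mx_onE (x : {'GL_n[F]}) : regular_mx_on (GLval x) = aG x.
Proof. by rewrite /regular_mx_on valK. Qed.

Lemma regular_mx_on1 : regular_mx_on 1%:M = 1%:M.
Proof.
rewrite -[1%:M in LHS]/(GLval (1%g : {'GL_n[F]})).
by rewrite regular_mx_onE repr_mx1.
Qed.

Lemma regular_mx_onM A B :
  regular_mx_on (A *m B) = regular_mx_on A *m regular_mx_on B.
Proof.
rewrite {2 3}/regular_mx_on; case: insubP => [x _ <-|nA]; last first.
  rewrite mul0mx /regular_mx_on insubN //; apply: contra nA.
  by rewrite [_ \is a _]unitmx_mul; case/andP.
case: insubP => [y _ <-|nB]; last first.
  rewrite mulmx0 /regular_mx_on insubN //; apply: contra nB.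
  by rewrite [_ \is a _]unitmx_mul; case/andP.
rewrite -repr_mxM; [|by rewrite inE..].
by rewrite -regular_mx_onE GL_MxE.
Qed.

Lemma avg_mean (H : {group {'GL_n[F]}}) :
  avg C G H = mean regular_mx_on [set GLval x | x in H].
Proof.
rewrite /avg /gset_mx meanE card_imset; last exact: val_inj.
rewrite big_imset /=; last by move=> x y _ _; apply: val_inj.
by congr (_ *: _); apply: eq_bigr => x _; rewrite regular_mx_onE.
Qed.

End Bridge.

Lemma reshape_index_ones n i : (i < n)%N -> reshape_index (nseq n 1%N) i = i.
Proof.
elim: n i => // n IH [|i] // lt; rewrite /reshape_index /= subn1.
by congr _.+1; apply: IH.
Qed.

Lemma reshape_index_last m i :
  (i <= m)%N -> reshape_index [:: m; 1%N] i = (m <= i)%N.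
Proof.
move=> im; rewrite /reshape_index /= subn_eq0; case: ltnP => // mi.
by rewrite -subnDA; case: eqP => //; lia.
Qed.

Section Unipotent.
Variables (F : finFieldType) (n : nat).

Lemma block_unitriangularE mu (A : 'M[F]_n.-1.+1) :
  block_unitriangular (F := F) (n := n) mu A =
  (A \in pattern F (fun i j => (reshape_index mu i < reshape_index mu j)%N)).
Proof.
rewrite inE; apply: eq_forallb => i; apply: eq_forallb => j.
rewrite -leqNgt.
case: (ltngtP (reshape_index mu i) (reshape_index mu j)) => //= lt_ji.
by rewrite andbT; have [ij|] := eqVneq i j; [rewrite ij ltnn in lt_ji|].
Qed.

Lemma eq_pattern d (r r' : rel 'I_d) : r =2 r' -> pattern F r = pattern F r'.
Proof.
move=> rr; apply/setP=> A; apply/patternP/patternP=> rA i j nr; apply: rA.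
  by rewrite rr.
by rewrite -rr.
Qed.

Lemma pattern_tr d (r : rel 'I_d) (A : 'M[F]_d) :
  (A^T \in pattern F r) = (A \in pattern F (fun i j => r j i)).
Proof.
apply/patternP/patternP=> rA i j nr; have := rA j i nr; rewrite !mxE eq_sym.
  exact.
exact.
Qed.

Lemma GLval_unip mu (r : rel 'I_n.-1.+1) :
  mgroup (pattern F r) ->
  (fun i j : 'I_n.-1.+1 => (reshape_index mu i < reshape_index mu j)%N) =2 r ->
  [set GLval x | x in unip F n mu] = pattern F r.
Proof.
move=> [_ _ rU] /eq_pattern rE; apply/setP=> A; apply/imsetP/idP.
  by case=> x; rewrite inE block_unitriangularE rE => rx ->.
move=> rA; exists (FinRing.Unit (rU _ rA)) => //.
by rewrite inE block_unitriangularE rE.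
Qed.

Lemma GLval_unip_op mu (r : rel 'I_n.-1.+1) :
  mgroup (pattern F r) ->
  (fun i j : 'I_n.-1.+1 => (reshape_index mu j < reshape_index mu i)%N) =2 r ->
  [set GLval x | x in unip_op F n mu] = pattern F r.
Proof.
move=> [_ _ rU] /eq_pattern rE; apply/setP=> A; apply/imsetP/idP.
  by case=> x; rewrite inE block_unitriangularE pattern_tr rE => rx ->.
move=> rA; exists (FinRing.Unit (rU _ rA)) => //.
by rewrite inE block_unitriangularE pattern_tr rE.
Qed.

End Unipotent.

Lemma GLval_unip1n (F : finFieldType) n : (2 <= n)%N ->
  [set GLval x | x in unip1n F n] = pattern F (@upper_rel n.-1.+1).
Proof.
move=> n2; apply: GLval_unip; first exact: mgroup_upper.
move=> i j; rewrite !reshape_index_ones //; have := ltn_ord i;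
  have := ltn_ord j; lia.
Qed.

(** e absorbs the two outer averages of the Radon element, whose group lies in
U; the scalar is the square of the order q^(n-1) of the column group. *)
Lemma radon_yokonumaE (F : finFieldType) (n : nat) (C : numClosedFieldType) :
  (2 <= n)%N ->
  radon_yokonuma C F n [:: n.-1; 1%N] =
    jucys_murphy (regular_mx_on C (n := n)) ord_max.
Proof.
case: n => [|[|m]] // _; set rho := regular_mx_on C (n := m.+2).
have rho1 := regular_mx_on1 F m.+2 C; have rhoM := @regular_mx_onM F m.+2 C.
rewrite /radon_yokonuma /radon !avg_mean GLval_unip1n //.
have U : [set GLval x | x in unip F m.+2 [:: m.+1; 1%N]] =
    pattern F (col_rel (@ord_max m.+1)).
  apply: GLval_unip; first exact: mgroup_col.
  move=> i j; rewrite !reshape_index_last -1?ltnS // /col_rel -val_eqE /=.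
  have := ltn_ord i; have := ltn_ord j.
  by case: (ltnP m i); case: (ltnP m j) => /=; lia.
have -> : [set GLval x | x in unip_op F m.+2 [:: m.+1; 1%N]] =
    pattern F (row_rel (@ord_max m.+1)).
  apply: GLval_unip_op; first exact: mgroup_row.
  move=> i j; rewrite !reshape_index_last -1?ltnS // /row_rel -val_eqE /=.
  have := ltn_ord i; have := ltn_ord j.
  by case: (ltnP m i); case: (ltnP m j) => /=; lia.
have -> : #|unip F m.+2 [:: m.+1; 1%N]| = (#|F| ^ m.+1)%N.
  have GL_inj : injective (@GLval m.+2 F) by exact: val_inj.
  rewrite -(card_imset _ GL_inj) U card_pattern; congr (_ ^ _)%N.
  pose f (i : 'I_m.+1) : 'I_m.+2 * 'I_m.+2 := (widen_ord (leqnSn _) i, ord_max).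
  have f_inj : injective f by move=> i j [] /val_inj.
  rewrite -[RHS]card_ord -(card_imset _ f_inj); apply: eq_card => -[i j].
  rewrite inE /col_rel; apply/andP/imsetP=> [/= [/eqP-> im]|[i' _ [-> ->]] /=].
    by exists (Ordinal im) => //; congr (_, _); apply: val_inj.
  by rewrite eqxx.
have gc := mgroup_col F (@ord_max m.+1).
rewrite U /jucys_murphy -scalemxAr -scalemxAl natrX natrX -exprM mulnC !mulmxA.
congr (_ *: _).
have cu i j : col_rel (@ord_max m.+1) i j -> upper_rel i j.
  by case/andP=> /eqP->.
rewrite (mean_upper_mulr rhoM gc cu) -(mulmxA (_ *m _)).
by rewrite (mean_upper_mull rhoM gc cu).
Qed.

Theorem proposition6p19 (R : realType) (F : finFieldType) (n : nat)
    (hn : (2 <= n)%N) (a : R[i])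
    (ha : right_mul_eigenvalue (yokonuma_hecke R[i] F n)
            (radon_yokonuma R[i] F n [:: n.-1; 1%N]) a) :
  exists2 k : nat, (k <= 2 * n - 2)%N & a = #|F|%:R ^+ k.
Proof.
case: ha => v [/hecke_algebraP[x _ vE] v0]; rewrite radon_yokonumaE // => vR.
have rhoM := @regular_mx_onM F n R[i].
rewrite avg_mean GLval_unip1n // in vE.
have ve : v *m mean (regular_mx_on R[i] (n := n))
    (pattern F (@upper_rel n.-1.+1)) = v.
  by rewrite vE -mulmxA mean_upper_idem.
have [i vi0] : exists i, row i v != 0.
  apply/existsP; apply: contraR v0; rewrite negb_exists => /forallP v_rows.
  apply/eqP/row_matrixP=> i; rewrite row0.
  by apply/eqP; rewrite -[_ == _]negbK v_rows.
have ie : row i v *m mean (regular_mx_on R[i] (n := n))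
    (pattern F (@upper_rel n.-1.+1)) = row i v by rewrite -row_mul ve.
have iR : row i v *m jucys_murphy (regular_mx_on R[i] (n := n)) ord_max =
    a *: row i v by rewrite -row_mul vR linearZ.
have [k kn ->] :=
  jucys_murphy_eigenvalue (regular_mx_on1 F n R[i]) rhoM vi0 ie iR.
by exists k => //; move: kn => /=; lia.
Qed.
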